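(* Let $p \geq 3$ be a prime and let $D$ be a positive integer with $3 \mid D$ and $p \nmid D$. Then there is at most one $p$-tuple of odd primes at equal distance $2D$, namely the $p$-tuple $p,\ p+2D,\ \ldots,\ p+2(p-1)D$. That is, if $q$ is an integer such that $q,\ q+2D,\ \ldots,\ q+2(p-1)D$ are all odd primes, then $q=p$.
   Context: All prime number multiplets consist of odd primes only. A $p$-tuple at equal distance $2D$ is a sequence of $p$ odd primes in which each consecutive pair of members differs by exactly $2D$, i.e. $q, q+2D, \ldots, q+2(p-1)D$ (the members need not be consecutive primes). Such a tuple is called exceptional (or a singlet) if it is the only tuple of primes of that length with the given distances. *)

(* Defs.v *)
From mathcomp Require Import all_boot all_order all_algebra.

Set Implicit Arguments.
Unset Strict Implicit.
Unset Printing Implicit Defensive.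

Import Order.TTheory GRing.Theory Num.Theory.
Local Open Scope ring_scope.

(* Primes are positive: the sign test is needed because `|z|%N forgets the
   sign. *)
Definition odd_prime (z : int) : bool :=
  [&& 0 <= z, prime `|z|%N & odd `|z|%N].

(* The members are not required to be consecutive primes. *)
Definition equidistant_prime_tuple (n d : nat) (t : n.-tuple int) : bool :=
  all odd_prime t && sorted [rel x y : int | y == x + d%:Z] t.

(* Main.v *)
Require Import Defs.
From mathcomp Require Import all_boot all_order all_algebra.

Import Order.TTheory GRing.Theory Num.Theory.
Local Open Scope ring_scope.

(** Let q, q + d, ..., q + (p - 1) d all be prime, with d prime to the prime p.
    As d is invertible modulo p, the terms run through every residue class
    modulo p, so one of them is divisible by p and hence equal to p; therefore
    q <= p. If q < p, the term of index q would be among the p given ones; but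
    it is q + q d = q (1 + d), which is composite. Hence q = p.
    This is [prime_progression_start]; the theorem is the case d = 2 D, where
    p does not divide 2 D because p is odd and does not divide D. The
    tuple form follows because an equidistant tuple is determined by its first
    entry ([equidistant_nth]). *)

(** The index is q a mod p, where a is the inverse of - d modulo p:
    then q + q a d = q (1 + a d) vanishes modulo p. *)
Lemma progression_hits_multiple (p d q : nat) :
  (0 < p)%N -> coprime p d -> exists2 i, (i < p)%N & (p %| q + i * d)%N.
Proof.
move=> p_gt0 co_pd; have [a _] := Bezoutl d p_gt0.
rewrite (eqP co_pd) => dvd_a.
exists ((q * a) %% p)%N; first by rewrite ltn_mod.
rewrite /dvdn -modnDmr modnMml modnDmr -/(dvdn _ _).
by rewrite -mulnA -mulnS dvdn_mull // -add1n.
Qed.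

Lemma prime_progression_start (p d q : nat) :
    prime p -> coprime p d ->
    (forall i, (i < p)%N -> prime (q + i * d)) ->
  q = p.
Proof.
move=> p_pr co_pd q_pr; have p_gt0 := prime_gt0 p_pr.
have d_gt0 : (0 < d)%N.
  case: d co_pd {q_pr} => // ; rewrite /coprime gcdn0 => /eqP p1.
  by rewrite p1 in p_pr.
have q_gt1 : (1 < q)%N.
  by have := prime_gt1 (q_pr 0 p_gt0); rewrite mul0n addn0.
have le_pq : (p <= q)%N.
  rewrite leqNgt; apply/negP => /q_pr; rewrite -mulnS => /primeP[_ /(_ q)].
  rewrite dvdn_mulr // => /(_ isT); rewrite gtn_eqF //= => /eqP q_eq.
  have : (q * 1 < q * d.+1)%N by rewrite ltn_mul2l (ltnW q_gt1).
  by rewrite -q_eq muln1 ltnn.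
have [i lt_ip dvd_p] := progression_hits_multiple p d q p_gt0 co_pd.
have := dvd_p; rewrite (dvdn_prime2 p_pr (q_pr i lt_ip)) => /eqP p_eq.
apply/eqP; rewrite eqn_leq le_pq andbT.
by rewrite [X in (_ <= X)%N]p_eq leq_addr.
Qed.

Lemma equidistant_nth (n d : nat) (t : n.-tuple int) (i : nat) :
    equidistant_prime_tuple d t -> (i < n)%N ->
  nth 0 t i = nth 0 t 0 + (i * d)%N%:Z.
Proof.
move=> /andP[_ /(sortedP 0) step].
elim: i => [|i IHi] lt_in; first by rewrite mul0n addr0.
have lt_it : (i.+1 < size t)%N by rewrite size_tuple.
by rewrite (eqP (step i lt_it)) (IHi (ltnW lt_in)) mulSn addnC PoszD addrA.
Qed.

Theorem corollary3 (p D : nat) (p_ge3 : (3 <= p)%N) (p_prime : prime p)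
    (D_gt0 : (0 < D)%N) (dvd3D : (3 %| D)%N) (ndvd_pD : ~~ (p %| D)%N) :
  (forall t : p.-tuple int,
      equidistant_prime_tuple (2 * D) t ->
      t = [tuple p%:Z + (2 * i * D)%N%:Z | i < p])
  /\
  (forall q : int,
      (forall i : nat, (i < p)%N -> odd_prime (q + (2 * i * D)%N%:Z)) ->
      q = p%:Z).
Proof.
have distE i : (2 * i * D = i * (2 * D))%N by rewrite mulnCA mulnA.
have co_p2D : coprime p (2 * D).
  by rewrite prime_coprime // Euclid_dvdM // negb_or ndvd_pD andbT gtnNdvd.
have startE q :
    (forall i : nat, (i < p)%N -> odd_prime (q + (2 * i * D)%N%:Z)) ->
    q = p%:Z.
  move=> q_pr; have /and3P[] := q_pr 0%N (prime_gt0 p_prime).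
  rewrite muln0 mul0n addr0; case: q q_pr => // q q_pr _ _ _.
  congr Posz; apply: (prime_progression_start _ _ _ p_prime co_p2D) => i lt_ip.
  by have /and3P[_ + _] := q_pr i lt_ip; rewrite distE -PoszD.
split=> // t eq_t.
have t0E : nth 0 t 0 = p%:Z.
  apply: startE => i lt_ip; rewrite distE -(equidistant_nth _ _ _ _ eq_t) //.
  by have /andP[/allP all_pr _] := eq_t; apply/all_pr/mem_nth; rewrite size_tuple.
apply: eq_from_tnth => i; rewrite tnth_mktuple (tnth_nth 0).
by rewrite (equidistant_nth _ _ _ _ eq_t) // t0E distE.
Qed.
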